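(* Let $\mathcal K=\mathcal R\mathcal J$ be the operator on the tangent bundle of the Ablowitz--Ladik phase space $\mathcal C$ defined in the context. Then $\mathcal K$ is skew-symmetric with respect to the bilinear form $\langle\cdot,\cdot\rangle$; in particular $\{F,G\}_{\mathcal K}=\langle\nabla F,\mathcal K\nabla G\rangle=-\{G,F\}_{\mathcal K}$ for functionals $F,G$ on $\mathcal C$.
   Context: Phase space. $\mathcal C$ is the space of sequences $(q_k,r_k)^T_{k\in\mathbb Z}$ in $\mathbb C^2$ with $|q_k|,|r_k|\to0$ as $k\to\pm\infty$; potentials are assumed to vanish rapidly (so that all sums below converge) and $1-r_kq_k\ne0$. On the tangent space at $(q,r)^T$ one has the (non-Hermitian) bilinear form $$\langle(a,b)^T,(c,d)^T\rangle=-\sum_{k\in\mathbb Z}(a_kd_k+b_kc_k)(1-q_kr_k)^{-1},$$ and $^*$ denotes the adjoint with respect to it. The functional gradient of a functional $F$ on $\mathcal C$ is $\nabla_kF=-(1-q_kr_k)\,(\delta F/\delta r_k,\ \delta F/\delta q_k)^T$. Let $\mathcal J$ act as $\mathrm{diag}(-i,i)$ at each site and let $\sigma_3=\mathrm{diag}(1,-1)$. Operators. For $w=(u_k,v_k)^T_{k\in\mathbb Z}$ put $s_j=\dfrac{q_ju_j-r_jv_j}{1-r_jq_j}$ and $$(Lw)_k=\begin{pmatrix} u_{k-1}-(1-r_kq_k)r_{k-1}\sum_{j\ge k}s_j-r_k\sum_{j\ge k}(q_ju_{j-1}-r_jv_{j+1})\\ v_{k+1}-(1-r_kq_k)q_{k+1}\sum_{j\ge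 k+1}s_j-q_k\sum_{j\ge k+1}(q_ju_{j-1}-r_jv_{j+1})\end{pmatrix},$$ $$(L^{-1}w)_k=\begin{pmatrix} u_{k+1}+(1-r_kq_k)r_{k+1}\sum_{j\ge k+1}s_j+r_k\sum_{j\ge k+1}(q_ju_{j+1}-r_jv_{j-1})\\ v_{k-1}+(1-r_kq_k)q_{k-1}\sum_{j\ge k}s_j+q_k\sum_{j\ge k}(q_ju_{j+1}-r_jv_{j-1})\end{pmatrix}.$$ Set $\mathcal L_+=L+L^{-1}$ and $\mathcal L_-=\sigma_3\mathcal L_+^*\sigma_3^{-1}$; explicitly, with $t_j=q_j(u_{j+1}-u_{j-1})+r_j(v_{j+1}-v_{j-1})$, $$(\mathcal L_-w)_k=\begin{pmatrix} u_{k+1}+u_{k-1}-(1-r_kq_k)\left[r_{k+1}\sum_{j\le k}s_j-r_{k-1}\sum_{j\le k-1}s_j\right]-r_k\sum_{j\le k}t_j-r_kq_ku_{k-1}+r_k^2v_{k+1}\\ v_{k+1}+v_{k-1}+(1-r_kq_k)\left[q_{k+1}\sum_{j\le k}s_j-q_{k-1}\sum_{j\le k-1}s_j\right]-q_k\sum_{j\le k}t_j+q_k^2u_{k+1}-q_kr_kv_{k-1}\end{pmatrix}.$$ Finally $$\mathcal R=\begin{pmatrix}0&1\\-1&0\end{pmatrix}(\mathcal L_++\mathcal L_-)\begin{pmatrix}0&-1\\1&0\end{pmatrix},\qquad \mathcal K=\mathcal R\mathcal J.$$ *)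

(* Defs.v *)
From Stdlib Require Import Reals ZArith.
From Coquelicot Require Import Coquelicot.

Open Scope C_scope.

(** ** Sums over the lattice *)

(* [Series] is total: every sum below is taken of an absolutely convergent
   family whenever the base point is in [phase_space] and the vectors involved
   are in [tangent] (Cauchy-Schwarz). *)
Definition CSeries (a : nat -> C) : C :=
  (Series (fun n => Re (a n)), Series (fun n => Im (a n))).

Definition sum_ge (k : Z) (a : Z -> C) : C :=
  CSeries (fun n => a (k + Z.of_nat n)%Z).

Definition sum_le (k : Z) (a : Z -> C) : C :=
  CSeries (fun n => a (k - Z.of_nat n)%Z).

Definition sum_Z (a : Z -> C) : C := sum_ge 0 a + sum_le (-1) a.

(** ** Phase space and tangent vectors *)

(* Column vectors [(a_k, b_k)^T] indexed by the site [k]; used both for points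
   [(q, r)^T] of the phase space and for tangent vectors [(u, v)^T]. *)
Definition vecseq : Type := Z -> C * C.

Definition fst_at (w : vecseq) (k : Z) : C := fst (w k).
Definition snd_at (w : vecseq) (k : Z) : C := snd (w k).

Definition vanishes_at_infinity (a : Z -> C) : Prop :=
  is_lim_seq (fun n => Cmod (a (Z.of_nat n))) 0 /\
  is_lim_seq (fun n => Cmod (a (- Z.of_nat n)%Z)) 0.

Definition square_summable (a : Z -> C) : Prop :=
  ex_series (fun n => (Cmod (a (Z.of_nat n)) ^ 2)%R) /\
  ex_series (fun n => (Cmod (a (- Z.of_nat n)%Z) ^ 2)%R).

(* Square-summability is the decay under which every pairing of two tangent
   vectors and every nonlocal sum below converges absolutely; it is weaker than
   any faster decay (summable, Schwartz, finitely supported). *)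
Definition phase_space (p : vecseq) : Prop :=
  (vanishes_at_infinity (fst_at p) /\ vanishes_at_infinity (snd_at p)) /\
  (square_summable (fst_at p) /\ square_summable (snd_at p)) /\
  (forall k : Z, 1 - snd_at p k * fst_at p k <> 0).

(* The tangent space is the same at every point. *)
Definition tangent (w : vecseq) : Prop :=
  square_summable (fst_at w) /\ square_summable (snd_at w).

Definition tangent_endo (A : vecseq -> vecseq) : Prop :=
  forall w : vecseq, tangent w -> tangent (A w).

(** ** The bilinear form *)

(* No complex conjugation: the form is bilinear and symmetric. *)
Definition form (p w w' : vecseq) : C :=
  - sum_Z (fun k =>
      (fst_at w k * snd_at w' k + snd_at w k * fst_at w' k)
      / (1 - fst_at p k * snd_at p k)).

(* [B] is the adjoint [A^*] at [p]. *)
Definition is_adjoint (p : vecseq) (A B : vecseq -> vecseq) : Prop :=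
  tangent_endo A /\ tangent_endo B /\
  forall w w' : vecseq, tangent w -> tangent w' ->
    form p (A w) w' = form p w (B w').

Definition skew_symmetric (p : vecseq) (A : vecseq -> vecseq) : Prop :=
  tangent_endo A /\
  forall w w' : vecseq, tangent w -> tangent w' ->
    form p (A w) w' = - form p w (A w').

(** ** The operators *)

(* The constant matrix with rows [(a, b)] and [(c, d)], acting at each site. *)
Definition mat2 (a b c d : C) (w : vecseq) : vecseq := fun k =>
  (a * fst_at w k + b * snd_at w k, c * fst_at w k + d * snd_at w k).

Definition addf (w w' : vecseq) : vecseq := fun k =>
  (fst_at w k + fst_at w' k, snd_at w k + snd_at w' k).

(* [sigma3] is its own inverse. *)
Definition sigma3 : vecseq -> vecseq := mat2 1 0 0 (-1).

Definition opJ : vecseq -> vecseq := mat2 (- Ci) 0 0 Ci.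

Definition s_seq (p w : vecseq) (j : Z) : C :=
  let q := fst_at p in
  let r := snd_at p in
  (q j * fst_at w j - r j * snd_at w j) / (1 - r j * q j).

Definition opL (p w : vecseq) : vecseq := fun k =>
  let q := fst_at p in
  let r := snd_at p in
  let u := fst_at w in
  let v := snd_at w in
  let h := fun j : Z => q j * u (j - 1)%Z - r j * v (j + 1)%Z in
  ( u (k - 1)%Z
      - (1 - r k * q k) * r (k - 1)%Z * sum_ge k (s_seq p w)
      - r k * sum_ge k h,
    v (k + 1)%Z
      - (1 - r k * q k) * q (k + 1)%Z * sum_ge (k + 1) (s_seq p w)
      - q k * sum_ge (k + 1) h ).

(* Given by its explicit formula, not as an abstract inverse. *)
Definition opLinv (p w : vecseq) : vecseq := fun k =>
  let q := fst_at p in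
  let r := snd_at p in
  let u := fst_at w in
  let v := snd_at w in
  let h := fun j : Z => q j * u (j + 1)%Z - r j * v (j - 1)%Z in
  ( u (k + 1)%Z
      + (1 - r k * q k) * r (k + 1)%Z * sum_ge (k + 1) (s_seq p w)
      + r k * sum_ge (k + 1) h,
    v (k - 1)%Z
      + (1 - r k * q k) * q (k - 1)%Z * sum_ge k (s_seq p w)
      + q k * sum_ge k h ).

Definition Lplus (p w : vecseq) : vecseq := addf (opL p w) (opLinv p w).

Definition t_seq (p w : vecseq) (j : Z) : C :=
  let q := fst_at p in
  let r := snd_at p in
  q j * (fst_at w (j + 1)%Z - fst_at w (j - 1)%Z)
  + r j * (snd_at w (j + 1)%Z - snd_at w (j - 1)%Z).

(* The explicit form of [sigma3 Lplus^* sigma3^-1]. *)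
Definition Lminus (p w : vecseq) : vecseq := fun k =>
  let q := fst_at p in
  let r := snd_at p in
  let u := fst_at w in
  let v := snd_at w in
  ( u (k + 1)%Z + u (k - 1)%Z
      - (1 - r k * q k) * (r (k + 1)%Z * sum_le k (s_seq p w)
                           - r (k - 1)%Z * sum_le (k - 1) (s_seq p w))
      - r k * sum_le k (t_seq p w)
      - r k * q k * u (k - 1)%Z + r k * r k * v (k + 1)%Z,
    v (k + 1)%Z + v (k - 1)%Z
      + (1 - r k * q k) * (q (k + 1)%Z * sum_le k (s_seq p w)
                           - q (k - 1)%Z * sum_le (k - 1) (s_seq p w))
      - q k * sum_le k (t_seq p w)
      + q k * q k * u (k + 1)%Z - q k * r k * v (k - 1)%Z ).

Definition opR (p w : vecseq) : vecseq :=
  let w1 := mat2 0 (-1) 1 0 w in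
  mat2 0 1 (-1) 0 (addf (Lplus p w1) (Lminus p w1)).

Definition opK (p w : vecseq) : vecseq := opR p (opJ w).

(** ** Functionals, gradients and the bracket *)

(* Only the values of a functional on the phase space matter: changing one
   coordinate of a point of the phase space by a small amount stays in it. *)
Definition functional : Type := vecseq -> C.

Definition set_q (p : vecseq) (k : Z) (z : C) : vecseq := fun j =>
  if Z.eqb j k then (z, snd_at p j) else p j.

Definition set_r (p : vecseq) (k : Z) (z : C) : vecseq := fun j =>
  if Z.eqb j k then (fst_at p j, z) else p j.

(* Functional derivatives on the lattice are the complex partial derivatives
   with respect to the independent coordinates [q_k] and [r_k]. *)
Definition delta_q (F : functional) (p : vecseq) (k : Z) : C :=
  C_derive (fun z => F (set_q p k z)) (fst_at p k).

Definition delta_r (F : functional) (p : vecseq) (k : Z) : C :=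
  C_derive (fun z => F (set_r p k z)) (snd_at p k).

Definition grad (F : functional) (p : vecseq) : vecseq := fun k =>
  ( - (1 - fst_at p k * snd_at p k) * delta_r F p k,
    - (1 - fst_at p k * snd_at p k) * delta_q F p k ).

Definition has_gradient (F : functional) (p : vecseq) : Prop :=
  (forall k : Z,
     @ex_derive C_AbsRing C_NormedModule
       (fun z => F (set_q p k z)) (fst_at p k) /\
     @ex_derive C_AbsRing C_NormedModule
       (fun z => F (set_r p k z)) (snd_at p k)) /\
  tangent (grad F p).

Definition bracketK (F G : functional) (p : vecseq) : C :=
  form p (grad F p) (opK p (grad G p)).

(* Main.v *)
Require Import Defs.
From Stdlib Require Import Reals ZArith Lra Lia FunctionalExtensionality.
From Coquelicot Require Import Coquelicot.

(** The adjointness of [L + L^-1] and [sigma3 Lminus sigma3] is a summation by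
    parts.  Write [w = (u, v)], [w' = (a, b)], let [S] and [X] be the tail sums
    of [s] and [t] at [w], and [P] and [Y] the prefix sums of [s] and [t] at
    [sigma3 w'].  The nonlocal part of [Lplus] involves [S] and [X], the one of
    [Lminus] involves [P] and [Y], and in the pairings these sums are multiplied,
    up to shifts, by the sequences whose sums appear on the other side.  Hence
    the difference
    of the summands of [<Lplus w, w'>] and [<w, sigma3 Lminus sigma3 w'>] at the
    site [k] is an exact difference [B (k + 1) - B k]
    ([Lplus_density_difference]), where [B] ([boundary]) is an explicit bilinear
    expression in the fields near [k] and in [S], [X], [P], [Y].  Each of its
    terms has a factor that tends to zero at a given end of the lattice, the
    other factors staying convergent there (tails vanish at [+oo], prefix sums
    at [-oo], fields at both), so the sum telescopes to zero
    ([boundary_Z_lim], [sum_Z_telescope]).  No exchange of double sums is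
    involved.

    All the sums converge absolutely: products of square-summable sequences are
    summable, and [/ (1 - r q)] is bounded because [1 - r q] tends to [1] at both
    ends.  The nonlocal sums are therefore bounded in [k],
    and they enter the operators multiplied by a square-summable coefficient,
    which is why the operators preserve the tangent space.

    Skew-symmetry of [K] is then algebra.  With [T = Lplus + Lminus] and
    [sigma3] skew for the form, adjointness becomes
    [<T w, w'> = - <sigma3 w, T (sigma3 w')>] ([form_Lsum_twisted]).  Let
    [rot] be the matrix with rows [(0, 1)], [(-1, 0)], which is self-adjoint, and
    [N = rot^-1 J], so that [K = rot T N].  Since [sigma3 rot = i N],
    [i sigma3 N = rot] and [T] commutes with [i],
    [<K w, w'> = <T N w, rot w'> = - <sigma3 N w, T (i N w')>
     = - <rot w, T N w'> = - <w, K w'>].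
    The antisymmetry of the bracket is this together with the symmetry of the
    form. *)

Open Scope C_scope.

(** * Summable and bounded families on the lattice *)

(** Two-sided statements are reduced to this one-sided notion by reflecting the
    lattice. *)
Definition half_summable (f : Z -> R) : Prop :=
  ex_series (fun n => f (Z.of_nat n)).

Definition Z_summable (f : Z -> R) : Prop :=
  half_summable f /\ half_summable (fun k => f (- k)%Z).

Lemma half_summable_shift_1 (f : Z -> R) :
  half_summable f <-> half_summable (fun k => f (1 + k)%Z).
Proof.
  unfold half_summable.
  transitivity (ex_series (fun n => f (Z.of_nat (S n)))).
  - apply (ex_series_incr_1 (fun n => f (Z.of_nat n))).
  - split; apply ex_series_ext; intros n; f_equal; lia.
Qed.

Lemma half_summable_shift (m : Z) (f : Z -> R) :
  half_summable f <-> half_summable (fun k => f (m + k)%Z).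
Proof.
  revert m f.
  assert (E : forall f g : Z -> R, (forall k, f k = g k) ->
                half_summable f <-> half_summable g).
  { intros f g H; split; apply ex_series_ext; intros n; auto. }
  apply (Z.bi_induction
    (fun m => forall f, half_summable f <-> half_summable (fun k => f (m + k)%Z))).
  - intros x y ->; reflexivity.
  - intros f; apply E; reflexivity.
  - intros m; split; intros IH f.
    + rewrite (IH f), (half_summable_shift_1 (fun k => f (m + k)%Z)).
      apply E; intros k; f_equal; lia.
    + rewrite (IH f), (half_summable_shift_1 (fun k => f (m + k)%Z)).
      apply E; intros k; f_equal; lia.
Qed.

Lemma Z_summable_shift (m : Z) (f : Z -> R) :
  Z_summable f -> Z_summable (fun k => f (k + m)%Z).
Proof.
  intros [H1 H2]; split.
  - apply (half_summable_shift m) in H1; revert H1.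
    apply ex_series_ext; intros n; f_equal; lia.
  - apply (half_summable_shift (- m)) in H2; revert H2.
    apply ex_series_ext; intros n; f_equal; lia.
Qed.

Lemma Z_summable_le (f g : Z -> R) :
  (forall k, 0 <= f k <= g k)%R -> Z_summable g -> Z_summable f.
Proof.
  intros H [H1 H2]; split.
  - apply (@ex_series_le R_AbsRing R_CompleteNormedModule _ _) with (2 := H1).
    intros n; change norm with Rabs; rewrite Rabs_pos_eq; apply H.
  - apply (@ex_series_le R_AbsRing R_CompleteNormedModule _ _) with (2 := H2).
    intros n; change norm with Rabs; rewrite Rabs_pos_eq; apply H.
Qed.

Lemma Z_summable_plus (f g : Z -> R) :
  Z_summable f -> Z_summable g -> Z_summable (fun k => f k + g k)%R.
Proof.
  intros [H1 H2] [H3 H4]; split.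
  - apply (ex_series_plus (fun n => f (Z.of_nat n)) _ H1 H3).
  - apply (ex_series_plus (fun n => f (- Z.of_nat n)%Z) _ H2 H4).
Qed.

Lemma Z_summable_scal (c : R) (f : Z -> R) :
  Z_summable f -> Z_summable (fun k => c * f k)%R.
Proof.
  intros [H1 H2]; split.
  - apply (ex_series_scal c (fun n => f (Z.of_nat n)) H1).
  - apply (ex_series_scal c (fun n => f (- Z.of_nat n)%Z) H2).
Qed.

(** With this encoding, [square_summable a] is by definition
    [Z_summable (fun k => Cmod (a k) ^ 2)], so that the two notions share their
    closure lemmas. *)
Definition abs_summable (a : Z -> C) : Prop := Z_summable (fun k => Cmod (a k)).

Definition Z_bounded (a : Z -> C) : Prop :=
  exists M : R, forall k, (Cmod (a k) <= M)%R.

Lemma square_summable_shift (m : Z) (a : Z -> C) :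
  square_summable a -> square_summable (fun k => a (k + m)%Z).
Proof. intros H; apply (Z_summable_shift m (fun k => Cmod (a k) ^ 2)%R H). Qed.

Lemma square_summable_plus (a b : Z -> C) :
  square_summable a -> square_summable b -> square_summable (fun k => a k + b k).
Proof.
  intros Ha Hb.
  apply (Z_summable_le (fun k => Cmod (a k + b k) ^ 2)%R
           (fun k => 2 * Cmod (a k) ^ 2 + 2 * Cmod (b k) ^ 2)%R).
  - intros k; split; [apply pow2_ge_0|].
    pose proof (Cmod_triangle (a k) (b k)).
    pose proof (Cmod_ge_0 (a k + b k)).
    assert (Cmod (a k + b k) ^ 2 <= (Cmod (a k) + Cmod (b k)) ^ 2)%R
      by (apply pow_incr; lra).
    pose proof (pow2_ge_0 (Cmod (a k) - Cmod (b k))); nra.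
  - apply Z_summable_plus; apply Z_summable_scal; assumption.
Qed.

Lemma square_summable_bounded_mult (a b : Z -> C) :
  Z_bounded a -> square_summable b -> square_summable (fun k => a k * b k).
Proof.
  intros [M HM] Hb.
  apply (Z_summable_le (fun k => Cmod (a k * b k) ^ 2)%R
           (fun k => M ^ 2 * Cmod (b k) ^ 2)%R).
  - intros k; split; [apply pow2_ge_0|].
    rewrite Cmod_mult, Rpow_mult_distr.
    apply Rmult_le_compat_r; [apply pow2_ge_0|].
    apply pow_incr; split; [apply Cmod_ge_0 | apply HM].
  - apply Z_summable_scal, Hb.
Qed.

Lemma abs_summable_plus (a b : Z -> C) :
  abs_summable a -> abs_summable b -> abs_summable (fun k => a k + b k).
Proof.
  intros Ha Hb.
  apply (Z_summable_le _ (fun k => Cmod (a k) + Cmod (b k))%R).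
  - intros k; split; [apply Cmod_ge_0 | apply Cmod_triangle].
  - apply Z_summable_plus; assumption.
Qed.

Lemma abs_summable_bounded_mult (a b : Z -> C) :
  Z_bounded a -> abs_summable b -> abs_summable (fun k => a k * b k).
Proof.
  intros [M HM] Hb.
  apply (Z_summable_le _ (fun k => M * Cmod (b k))%R).
  - intros k; split; [apply Cmod_ge_0|].
    rewrite Cmod_mult; apply Rmult_le_compat_r; [apply Cmod_ge_0 | apply HM].
  - apply Z_summable_scal, Hb.
Qed.

(** Young's inequality [x y <= x^2 + y^2] takes the place of Cauchy-Schwarz. *)
Lemma abs_summable_mult (a b : Z -> C) :
  square_summable a -> square_summable b -> abs_summable (fun k => a k * b k).
Proof.
  intros Ha Hb.
  apply (Z_summable_le _ (fun k => Cmod (a k) ^ 2 + Cmod (b k) ^ 2)%R).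
  - intros k; split; [apply Cmod_ge_0|].
    rewrite Cmod_mult.
    pose proof (pow2_ge_0 (Cmod (a k) - Cmod (b k))).
    pose proof (Rmult_le_pos _ _ (Cmod_ge_0 (a k)) (Cmod_ge_0 (b k))); nra.
  - apply Z_summable_plus; assumption.
Qed.

Lemma square_summable_opp (a : Z -> C) :
  square_summable a -> square_summable (fun k => - a k).
Proof.
  intros H; apply (Z_summable_le (fun k => Cmod (- a k) ^ 2)%R
    (fun k => Cmod (a k) ^ 2)%R); [|exact H].
  intros k; rewrite Cmod_opp; split; [apply pow2_ge_0 | apply Rle_refl].
Qed.

Lemma square_summable_mult_bounded (a b : Z -> C) :
  square_summable a -> Z_bounded b -> square_summable (fun k => a k * b k).
Proof.
  intros Ha Hb.
  rewrite (functional_extensionality (fun k => a k * b k) (fun k => b k * a k))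
    by (intros k; apply Cmult_comm).
  now apply square_summable_bounded_mult.
Qed.

Lemma abs_summable_opp (a : Z -> C) :
  abs_summable a -> abs_summable (fun k => - a k).
Proof.
  intros H; apply (Z_summable_le _ (fun k => Cmod (a k))); [|exact H].
  intros k; rewrite Cmod_opp; split; [apply Cmod_ge_0 | apply Rle_refl].
Qed.

Lemma abs_summable_mult_bounded (a b : Z -> C) :
  abs_summable a -> Z_bounded b -> abs_summable (fun k => a k * b k).
Proof.
  intros Ha Hb.
  rewrite (functional_extensionality (fun k => a k * b k) (fun k => b k * a k))
    by (intros k; apply Cmult_comm).
  now apply abs_summable_bounded_mult.
Qed.

Lemma bounded_const (c : C) : Z_bounded (fun _ => c).
Proof. exists (Cmod c); intros; apply Rle_refl. Qed.

Lemma bounded_shift (m : Z) (a : Z -> C) :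
  Z_bounded a -> Z_bounded (fun k => a (k + m)%Z).
Proof. intros [M H]; exists M; intros; apply H. Qed.

Lemma bounded_plus (a b : Z -> C) :
  Z_bounded a -> Z_bounded b -> Z_bounded (fun k => a k + b k).
Proof.
  intros [M H] [N K]; exists (M + N)%R; intros k.
  eapply Rle_trans; [apply Cmod_triangle | apply Rplus_le_compat; auto].
Qed.

Lemma bounded_opp (a : Z -> C) : Z_bounded a -> Z_bounded (fun k => - a k).
Proof. intros [M H]; exists M; intros k; rewrite Cmod_opp; apply H. Qed.

Lemma bounded_mult (a b : Z -> C) :
  Z_bounded a -> Z_bounded b -> Z_bounded (fun k => a k * b k).
Proof.
  intros [M H] [N K]; exists (M * N)%R; intros k.
  rewrite Cmod_mult; apply Rmult_le_compat; auto using Cmod_ge_0.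
Qed.

Lemma abs_summable_reflect (a : Z -> C) :
  abs_summable a -> abs_summable (fun j => a (- j)%Z).
Proof.
  intros [H1 H2]; split; [exact H2|].
  revert H1; apply ex_series_ext; intros n; now rewrite Z.opp_involutive.
Qed.

(** * Limits at both ends of the lattice *)

(** Limits are taken componentwise because [CSeries] is defined so. *)
Definition C_lim (u : nat -> C) (l : C) : Prop :=
  is_lim_seq (fun n => Re (u n)) (Re l) /\ is_lim_seq (fun n => Im (u n)) (Im l).

Lemma abs_Re_le_Cmod (z : C) : (Rabs (Re z) <= Cmod z)%R.
Proof. eapply Rle_trans; [apply Rmax_l | apply Rmax_Cmod]. Qed.

Lemma abs_Im_le_Cmod (z : C) : (Rabs (Im z) <= Cmod z)%R.
Proof. eapply Rle_trans; [apply Rmax_r | apply Rmax_Cmod]. Qed.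

Lemma Cmod_le_abs (z : C) : (Cmod z <= Rabs (Re z) + Rabs (Im z))%R.
Proof.
  unfold Cmod; apply Rsqr_incr_0_var.
  - rewrite Rsqr_sqrt by nra; unfold Rsqr, Re, Im.
    pose proof (Rabs_pos (fst z)); pose proof (Rabs_pos (snd z)).
    pose proof (pow2_abs (fst z)); pose proof (pow2_abs (snd z)); nra.
  - pose proof (Rabs_pos (Re z)); pose proof (Rabs_pos (Im z)); lra.
Qed.

Lemma C_lim_ext (u v : nat -> C) (l : C) :
  (forall n, u n = v n) -> C_lim u l -> C_lim v l.
Proof.
  intros E [H1 H2]; split; [revert H1 | revert H2];
    apply is_lim_seq_ext; intros n; now rewrite E.
Qed.

Lemma C_lim_const (c : C) : C_lim (fun _ => c) c.
Proof. split; apply is_lim_seq_const. Qed.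

Lemma C_lim_plus (u v : nat -> C) (l m : C) :
  C_lim u l -> C_lim v m -> C_lim (fun n => u n + v n) (l + m).
Proof. intros [] []; split; apply is_lim_seq_plus'; assumption. Qed.

Lemma C_lim_opp (u : nat -> C) (l : C) :
  C_lim u l -> C_lim (fun n => - u n) (- l).
Proof.
  intros [H1 H2]; split.
  - apply (proj1 (is_lim_seq_opp _ _) H1).
  - apply (proj1 (is_lim_seq_opp _ _) H2).
Qed.

Lemma C_lim_mult (u v : nat -> C) (l m : C) :
  C_lim u l -> C_lim v m -> C_lim (fun n => u n * v n) (l * m).
Proof.
  intros [] []; split.
  - apply is_lim_seq_minus'; apply is_lim_seq_mult'; assumption.
  - apply is_lim_seq_plus'; apply is_lim_seq_mult'; assumption.
Qed.

Lemma C_lim_inv (u : nat -> C) (l : C) :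
  l <> 0 -> C_lim u l -> C_lim (fun n => / u n) (/ l).
Proof.
  intros Hl [H1 H2].
  assert (N : (Re l ^ 2 + Im l ^ 2 <> 0)%R).
  { intros E; apply Hl; destruct l as [x y]; cbn [Re Im fst snd] in E.
    apply injective_projections; cbn; nra. }
  assert (HN : is_lim_seq (fun n => Re (u n) ^ 2 + Im (u n) ^ 2)%R
                 (Re l ^ 2 + Im l ^ 2)%R).
  { apply is_lim_seq_plus'; cbn [pow];
      repeat apply is_lim_seq_mult'; try assumption; apply is_lim_seq_const. }
  split.
  - apply is_lim_seq_div'; assumption.
  - apply is_lim_seq_div'; try assumption.
    apply (proj1 (is_lim_seq_opp _ _) H2).
Qed.

Lemma C_lim_incr_1 (u : nat -> C) (l : C) :
  C_lim u l <-> C_lim (fun n => u (S n)) l.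
Proof.
  unfold C_lim.
  rewrite (is_lim_seq_incr_1 (fun n => Re (u n))),
          (is_lim_seq_incr_1 (fun n => Im (u n))); reflexivity.
Qed.

Lemma C_lim_0_Cmod (u : nat -> C) :
  is_lim_seq (fun n => Cmod (u n)) 0 -> C_lim u 0.
Proof.
  intros H; split; apply is_lim_seq_abs_0.
  - apply is_lim_seq_le_le with (fun _ => 0%R) (fun n => Cmod (u n)).
    + intros n; split; [apply Rabs_pos | apply abs_Re_le_Cmod].
    + apply is_lim_seq_const.
    + exact H.
  - apply is_lim_seq_le_le with (fun _ => 0%R) (fun n => Cmod (u n)).
    + intros n; split; [apply Rabs_pos | apply abs_Im_le_Cmod].
    + apply is_lim_seq_const.
    + exact H.
Qed.

Lemma R_lim_bounded (u : nat -> R) (l : R) :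
  is_lim_seq u l -> exists M : R, forall n, (Rabs (u n) <= M)%R.
Proof.
  intros H; apply is_lim_seq_Reals in H.
  destruct (maj_by_pos u (exist _ l H)) as [M [_ HM]]; exists M; exact HM.
Qed.

Lemma C_lim_bounded (u : nat -> C) (l : C) :
  C_lim u l -> exists M : R, forall n, (Cmod (u n) <= M)%R.
Proof.
  intros [H1 H2].
  apply R_lim_bounded in H1; apply R_lim_bounded in H2.
  destruct H1 as [M1 H1], H2 as [M2 H2]; exists (M1 + M2)%R; intros n.
  eapply Rle_trans; [apply Cmod_le_abs|].
  apply Rplus_le_compat; auto.
Qed.

(** The limit at [-oo] comes first. *)
Definition Z_lim (f : Z -> C) (lm lp : C) : Prop :=
  C_lim (fun n => f (- Z.of_nat n)%Z) lm /\ C_lim (fun n => f (Z.of_nat n)) lp.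

Lemma Z_lim_const (c : C) : Z_lim (fun _ => c) c c.
Proof. split; apply C_lim_const. Qed.

Lemma Z_lim_plus (f g : Z -> C) (lm lp mm mp : C) :
  Z_lim f lm lp -> Z_lim g mm mp -> Z_lim (fun k => f k + g k) (lm + mm) (lp + mp).
Proof.
  intros [H1 H2] [H3 H4]; split.
  - apply (C_lim_plus _ _ _ _ H1 H3).
  - apply (C_lim_plus _ _ _ _ H2 H4).
Qed.

Lemma Z_lim_opp (f : Z -> C) (lm lp : C) :
  Z_lim f lm lp -> Z_lim (fun k => - f k) (- lm) (- lp).
Proof.
  intros [H1 H2]; split; [apply (C_lim_opp _ _ H1) | apply (C_lim_opp _ _ H2)].
Qed.

Lemma Z_lim_mult (f g : Z -> C) (lm lp mm mp : C) :
  Z_lim f lm lp -> Z_lim g mm mp -> Z_lim (fun k => f k * g k) (lm * mm) (lp * mp).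
Proof.
  intros [H1 H2] [H3 H4]; split.
  - apply (C_lim_mult _ _ _ _ H1 H3).
  - apply (C_lim_mult _ _ _ _ H2 H4).
Qed.

Lemma Z_lim_shift_pred (f : Z -> C) (lm lp : C) :
  Z_lim f lm lp -> Z_lim (fun k => f (k - 1)%Z) lm lp.
Proof.
  intros [H1 H2]; split.
  - apply C_lim_incr_1 in H1; revert H1.
    apply C_lim_ext; intros n; f_equal; lia.
  - apply C_lim_incr_1; revert H2.
    apply C_lim_ext; intros n; f_equal; lia.
Qed.

(** Covers sequences that do not vanish at infinity: tail sums, prefix sums and
    [/ (1 - r q)]. *)
Lemma Z_lim_bounded (f : Z -> C) (lm lp : C) : Z_lim f lm lp -> Z_bounded f.
Proof.
  intros [H1 H2].
  apply C_lim_bounded in H1; apply C_lim_bounded in H2.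
  destruct H1 as [M1 H1], H2 as [M2 H2].
  exists (Rmax M1 M2); intros k.
  destruct (Z.le_ge_cases 0 k) as [Hk | Hk].
  - eapply Rle_trans; [|apply Rmax_r].
    specialize (H2 (Z.to_nat k)); rewrite Z2Nat.id in H2 by lia; exact H2.
  - eapply Rle_trans; [|apply Rmax_l].
    specialize (H1 (Z.to_nat (- k))); rewrite Z2Nat.id, Z.opp_involutive in H1 by lia.
    exact H1.
Qed.

Lemma square_summable_Z_lim (a : Z -> C) : square_summable a -> Z_lim a 0 0.
Proof.
  assert (N : forall u : nat -> C,
    ex_series (fun n => Cmod (u n) ^ 2)%R -> C_lim u 0).
  { intros u H; apply C_lim_0_Cmod.
    apply ex_series_lim_0 in H.
    apply is_lim_seq_ext with (fun n => sqrt (Cmod (u n) ^ 2)).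
    - intros n; apply sqrt_pow2, Cmod_ge_0.
    - rewrite <- sqrt_0.
      apply is_lim_seq_continuous; [apply continuity_pt_sqrt; lra | exact H]. }
  intros [H1 H2]; split; apply N; assumption.
Qed.

Lemma square_summable_bounded (a : Z -> C) : square_summable a -> Z_bounded a.
Proof. intros H; exact (Z_lim_bounded _ _ _ (square_summable_Z_lim _ H)). Qed.

(** * Sums over the lattice *)

Lemma CSeries_ext (a b : nat -> C) :
  (forall n, a n = b n) -> CSeries a = CSeries b.
Proof.
  intros E; unfold CSeries; f_equal; apply Series_ext; intros n; now rewrite E.
Qed.

Lemma ex_series_Re_Im (a : nat -> C) :
  ex_series (fun n => Cmod (a n)) ->
  ex_series (fun n => Re (a n)) /\ ex_series (fun n => Im (a n)).
Proof.
  intros H; split;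
    apply (@ex_series_le R_AbsRing R_CompleteNormedModule _ _) with (2 := H);
    intros n; [apply abs_Re_le_Cmod | apply abs_Im_le_Cmod].
Qed.

Lemma CSeries_plus (a b : nat -> C) :
  ex_series (fun n => Cmod (a n)) -> ex_series (fun n => Cmod (b n)) ->
  CSeries (fun n => a n + b n) = CSeries a + CSeries b.
Proof.
  intros Ha Hb.
  apply ex_series_Re_Im in Ha; apply ex_series_Re_Im in Hb.
  destruct Ha as [Ha1 Ha2], Hb as [Hb1 Hb2].
  apply injective_projections; cbn [CSeries Cplus fst snd].
  - apply (Series_plus _ _ Ha1 Hb1).
  - apply (Series_plus _ _ Ha2 Hb2).
Qed.

Lemma CSeries_incr_1 (a : nat -> C) :
  ex_series (fun n => Cmod (a n)) ->
  CSeries a = a O + CSeries (fun n => a (S n)).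
Proof.
  intros H; apply ex_series_Re_Im in H; destruct H as [H1 H2].
  apply injective_projections; cbn [CSeries Cplus fst snd].
  - apply (Series_incr_1 _ H1).
  - apply (Series_incr_1 _ H2).
Qed.

Lemma CSeries_opp (a : nat -> C) : CSeries (fun n => - a n) = - CSeries a.
Proof.
  apply injective_projections; cbn [CSeries Copp fst snd].
  - apply (Series_opp (fun n => Re (a n))).
  - apply (Series_opp (fun n => Im (a n))).
Qed.

(** Multiplication by [i] exchanges real and imaginary parts up to sign, so it
    commutes with the total sum even where the series diverges; a general
    scalar would mix the two component series. *)
Lemma CSeries_Ci (a : nat -> C) :
  CSeries (fun n => Ci * a n) = Ci * CSeries a.
Proof.
  unfold CSeries, Ci, Cmult; cbn [fst snd].
  f_equal.
  - rewrite Rmult_0_l, Rminus_0_l, Rmult_1_l, <- Series_opp.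
    apply Series_ext; intros n; unfold Re, Im; cbn; ring.
  - rewrite Rmult_0_l, Rplus_0_l, Rmult_1_l.
    apply Series_ext; intros n; unfold Re, Im; cbn; ring.
Qed.

Lemma CSeries_telescope (u : nat -> C) (l : C) :
  C_lim u l -> CSeries (fun n => u (S n) - u n) = l - u O.
Proof.
  assert (N : forall (x : nat -> R) (y : R),
    is_lim_seq x y -> Series (fun n => x (S n) - x n)%R = (y - x O)%R).
  { intros x y H; apply is_series_unique.
    change (is_lim_seq (sum_n (fun n => x (S n) - x n)%R) (y - x O)%R).
    apply (is_lim_seq_ext (fun n => x (S n) - x O)%R).
    - intros n; induction n as [|n IH].
      + rewrite sum_O; reflexivity.
      + rewrite sum_Sn, <- IH; unfold plus; cbn; ring.
    - apply is_lim_seq_minus'; [|apply is_lim_seq_const].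
      apply (is_lim_seq_incr_1 x), H. }
  intros [H1 H2]; apply injective_projections; cbn [CSeries fst snd].
  - apply (N _ _ H1).
  - apply (N _ _ H2).
Qed.

Lemma ex_series_tail (k : Z) (a : Z -> C) :
  abs_summable a -> ex_series (fun n => Cmod (a (k + Z.of_nat n)%Z)).
Proof. intros [H _]; apply (half_summable_shift k) in H; exact H. Qed.

Lemma sum_le_reflect (k : Z) (a : Z -> C) :
  sum_le k a = sum_ge (- k) (fun j => a (- j)%Z).
Proof. apply CSeries_ext; intros n; f_equal; lia. Qed.

Lemma sum_Z_ext (a b : Z -> C) : (forall k, a k = b k) -> sum_Z a = sum_Z b.
Proof.
  intros E; unfold sum_Z, sum_ge, sum_le.
  f_equal; apply CSeries_ext; intros n; apply E.
Qed.

Lemma sum_Z_opp (a : Z -> C) : sum_Z (fun k => - a k) = - sum_Z a.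
Proof. unfold sum_Z, sum_ge, sum_le; rewrite !CSeries_opp; ring. Qed.

Lemma sum_Z_plus (a b : Z -> C) :
  abs_summable a -> abs_summable b ->
  sum_Z (fun k => a k + b k) = sum_Z a + sum_Z b.
Proof.
  intros Ha Hb; unfold sum_Z; rewrite !sum_le_reflect.
  pose proof (ex_series_tail 1 _ (abs_summable_reflect a Ha)) as Ha'.
  pose proof (ex_series_tail 1 _ (abs_summable_reflect b Hb)) as Hb'.
  change (- -1)%Z with 1%Z.
  unfold sum_ge; rewrite CSeries_plus by (apply ex_series_tail; assumption).
  rewrite (CSeries_plus _ _ Ha' Hb'); ring.
Qed.

Lemma sum_ge_step (k : Z) (a : Z -> C) :
  abs_summable a -> sum_ge k a = a k + sum_ge (k + 1) a.
Proof.
  intros H; unfold sum_ge; rewrite CSeries_incr_1 by (apply ex_series_tail, H).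
  f_equal; [f_equal; cbn; lia|].
  apply CSeries_ext; intros n; f_equal; lia.
Qed.

Lemma sum_le_step (k : Z) (a : Z -> C) :
  abs_summable a -> sum_le k a = a k + sum_le (k - 1) a.
Proof.
  intros H; rewrite !sum_le_reflect, sum_ge_step by (apply abs_summable_reflect, H).
  rewrite Z.opp_involutive; do 2 f_equal; lia.
Qed.

(** Any solution of the recurrence of partial sums converges; this gives the
    limits of tail sums from [sum_ge_step] alone. *)
Lemma is_lim_partial_sums (a : nat -> C) :
  ex_series (fun n => Cmod (a n)) ->
  forall u : nat -> C, (forall n, u (S n) = u n + a n) ->
  C_lim u (u O + CSeries a).
Proof.
  assert (N : forall (a x : nat -> R), ex_series a ->
    (forall n, x (S n) = x n + a n)%R -> is_lim_seq x (x O + Series a)%R).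
  { intros b x Hb Hx; apply Series_correct in Hb.
    apply is_lim_seq_incr_1.
    apply (is_lim_seq_ext (fun n => x O + sum_n b n)%R).
    - intros n; induction n as [|n IH].
      + rewrite sum_O, Hx; reflexivity.
      + rewrite sum_Sn, Hx, <- IH; unfold plus; cbn; ring.
    - apply is_lim_seq_plus'; [apply is_lim_seq_const | exact Hb]. }
  intros H u Hu; apply ex_series_Re_Im in H; destruct H as [H1 H2]; split.
  - apply (N _ (fun n => Re (u n)) H1); intros n; rewrite Hu; reflexivity.
  - apply (N _ (fun n => Im (u n)) H2); intros n; rewrite Hu; reflexivity.
Qed.

(** The limit at [-oo] is the total sum, in general not zero. *)
Lemma sum_ge_Z_lim (a : Z -> C) :
  abs_summable a -> exists l, Z_lim (fun k => sum_ge k a) l 0.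
Proof.
  intros Ha; eexists; split.
  - apply (is_lim_partial_sums (fun n => a (- Z.of_nat n - 1)%Z)).
    + pose proof (ex_series_tail 1 _ (abs_summable_reflect _ Ha)) as H.
      revert H; apply ex_series_ext; intros n; do 2 f_equal; lia.
    + intros n; rewrite sum_ge_step by assumption.
      rewrite Cplus_comm; f_equal; f_equal; lia.
  - replace (RtoC 0) with (sum_ge (Z.of_nat 0) a + CSeries (fun n => - a (Z.of_nat n))).
    + apply (is_lim_partial_sums (fun n => - a (Z.of_nat n))
              ) with (u := fun n => sum_ge (Z.of_nat n) a).
      * destruct Ha as [H _]; revert H; apply ex_series_ext; intros n.
        now rewrite Cmod_opp.
      * intros n; rewrite (sum_ge_step (Z.of_nat n)) by assumption.
        replace (Z.of_nat (S n)) with (Z.of_nat n + 1)%Z by lia; ring.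
    + rewrite CSeries_opp; apply Cplus_opp_r.
Qed.

Lemma sum_le_Z_lim (a : Z -> C) :
  abs_summable a -> exists l, Z_lim (fun k => sum_le k a) 0 l.
Proof.
  intros Ha.
  destruct (sum_ge_Z_lim _ (abs_summable_reflect _ Ha)) as [l [H1 H2]].
  exists l; split.
  - revert H2; apply C_lim_ext; intros n.
    rewrite sum_le_reflect; f_equal; lia.
  - revert H1; apply C_lim_ext; intros n; now rewrite sum_le_reflect.
Qed.

Lemma sum_Z_telescope (f : Z -> C) (lm lp : C) :
  Z_lim f lm lp -> sum_Z (fun k => f (k + 1)%Z - f k) = lp - lm.
Proof.
  intros [H1 H2]; unfold sum_Z.
  apply C_lim_opp, CSeries_telescope in H1.
  apply CSeries_telescope in H2.
  assert (E2 : sum_ge 0 (fun k => f (k + 1)%Z - f k) = lp - f 0%Z).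
  { transitivity (lp - f (Z.of_nat 0)); [rewrite <- H2 | reflexivity].
    apply CSeries_ext; intros n.
    replace (Z.of_nat (S n)) with (Z.of_nat n + 1)%Z by lia; reflexivity. }
  assert (E1 : sum_le (-1) (fun k => f (k + 1)%Z - f k) = - lm - - f 0%Z).
  { transitivity (- lm - - f (- Z.of_nat 0)%Z); [rewrite <- H1 | reflexivity].
    apply CSeries_ext; intros n.
    replace (-1 - Z.of_nat n + 1)%Z with (- Z.of_nat n)%Z by lia.
    replace (-1 - Z.of_nat n)%Z with (- Z.of_nat (S n))%Z by lia.
    ring. }
  rewrite E1, E2; ring.
Qed.

Lemma sum_ge_bounded (a : Z -> C) :
  abs_summable a -> Z_bounded (fun k => sum_ge k a).
Proof.
  intros H; destruct (sum_ge_Z_lim a H) as [l Hl].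
  exact (Z_lim_bounded _ _ _ Hl).
Qed.

Lemma sum_le_bounded (a : Z -> C) :
  abs_summable a -> Z_bounded (fun k => sum_le k a).
Proof.
  intros H; destruct (sum_le_Z_lim a H) as [l Hl].
  exact (Z_lim_bounded _ _ _ Hl).
Qed.

Lemma sum_ge_Ci (k : Z) (a b : Z -> C) :
  (forall j, b j = Ci * a j) -> sum_ge k b = Ci * sum_ge k a.
Proof.
  intros E; unfold sum_ge; rewrite <- CSeries_Ci; apply CSeries_ext; auto.
Qed.

Lemma sum_le_Ci (k : Z) (a b : Z -> C) :
  (forall j, b j = Ci * a j) -> sum_le k b = Ci * sum_le k a.
Proof.
  intros E; unfold sum_le; rewrite <- CSeries_Ci; apply CSeries_ext; auto.
Qed.

(** Closes a summability or boundedness goal by recursion on the shape of the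
    sequence.  At a product, the split of the factors into square-summable and
    bounded ones is found by backtracking. *)
Ltac summability :=
  unfold Cminus, Cdiv;
  match goal with
  | |- _ => assumption
  | |- square_summable (fun k => @?a k + @?b k) =>
      apply (square_summable_plus a b); summability
  | |- square_summable (fun k => - @?a k) =>
      apply (square_summable_opp a); summability
  | |- square_summable (fun k => ?a (k + ?m)%Z) =>
      apply (square_summable_shift m a); summability
  | |- square_summable (fun k => ?a (k - ?m)%Z) =>
      apply (square_summable_shift (- m) a); summability
  | |- square_summable (fun k => @?a k * @?b k) =>
      first [ apply (square_summable_mult_bounded a b); summability
            | apply (square_summable_bounded_mult a b); summability ]
  | |- abs_summable (fun k => @?a k + @?b k) =>
      apply (abs_summable_plus a b); summability
  | |- abs_summable (fun k => - @?a k) =>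
      apply (abs_summable_opp a); summability
  | |- abs_summable (fun k => @?a k * @?b k) =>
      first [ apply (abs_summable_mult a b); summability
            | apply (abs_summable_mult_bounded a b); summability
            | apply (abs_summable_bounded_mult a b); summability ]
  | |- Z_bounded (fun k => sum_ge k _) => apply sum_ge_bounded; summability
  | |- Z_bounded (fun k => sum_le k _) => apply sum_le_bounded; summability
  | |- Z_bounded (fun k => sum_ge (k + ?m)%Z ?a) =>
      apply (bounded_shift m (fun k => sum_ge k a)); summability
  | |- Z_bounded (fun k => sum_le (k - ?m)%Z ?a) =>
      apply (bounded_shift (- m) (fun k => sum_le k a)); summability
  | |- Z_bounded (fun k => @?a k + @?b k) => apply (bounded_plus a b); summability
  | |- Z_bounded (fun k => - @?a k) => apply (bounded_opp a); summability
  | |- Z_bounded (fun k => @?a k * @?b k) => apply (bounded_mult a b); summability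
  | |- Z_bounded (fun _ => ?c) => apply (bounded_const c)
  | |- Z_bounded _ => apply square_summable_bounded; summability
  end.

(** * The bilinear form *)

(** [1 - r q] has the limit [1] at both ends, which keeps it away from zero
    there. *)
Lemma phase_space_inv_bounded (p : vecseq) :
  phase_space p -> Z_bounded (fun k => / (1 - snd_at p k * fst_at p k)).
Proof.
  intros [_ [[Hq Hr] _]].
  apply square_summable_Z_lim in Hq; apply square_summable_Z_lim in Hr.
  pose proof (Z_lim_plus _ _ _ _ _ _ (Z_lim_const 1)
    (Z_lim_opp _ _ _ (Z_lim_mult _ _ _ _ _ _ Hr Hq))) as H.
  replace (1 + - (0 * 0)) with (RtoC 1) in H by ring.
  apply (Z_lim_bounded _ (/ 1) (/ 1)).
  destruct H as [H1 H2]; split; apply C_lim_inv; try assumption; apply C1_nz.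
Qed.

Lemma mat2_tangent (a b c d : C) : tangent_endo (mat2 a b c d).
Proof.
  intros w [Hu Hv]; split.
  - change (square_summable (fun k => a * fst_at w k + b * snd_at w k)).
    summability.
  - change (square_summable (fun k => c * fst_at w k + d * snd_at w k)).
    summability.
Qed.

Lemma addf_tangent (w w' : vecseq) : tangent w -> tangent w' -> tangent (addf w w').
Proof.
  intros [] []; split;
    [apply (square_summable_plus (fst_at w) (fst_at w'))
    |apply (square_summable_plus (snd_at w) (snd_at w'))]; assumption.
Qed.

Definition form_density (p w w' : vecseq) (k : Z) : C :=
  (fst_at w k * snd_at w' k + snd_at w k * fst_at w' k)
  / (1 - fst_at p k * snd_at p k).

Lemma form_density_summable (p w w' : vecseq) :
  phase_space p -> tangent w -> tangent w' -> abs_summable (form_density p w w').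
Proof.
  intros Hp [Hu Hv] [Ha Hb]; pose proof (phase_space_inv_bounded p Hp) as Hm.
  rewrite (functional_extensionality _ (fun k => / (1 - fst_at p k * snd_at p k))) in Hm
    by (intros k; now rewrite Cmult_comm).
  unfold form_density; summability.
Qed.

Lemma form_addf_l (p x y z : vecseq) :
  phase_space p -> tangent x -> tangent y -> tangent z ->
  form p (addf x y) z = form p x z + form p y z.
Proof.
  intros Hp Hx Hy Hz.
  transitivity (- (sum_Z (form_density p x z) + sum_Z (form_density p y z)));
    [|unfold form; fold (form_density p x z) (form_density p y z); ring].
  rewrite <- sum_Z_plus by (apply form_density_summable; assumption).
  unfold form; f_equal; apply sum_Z_ext; intros k.
  unfold form_density, addf, fst_at, snd_at, Cdiv; cbn [fst snd]; ring.
Qed.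

Lemma form_sym (p x y : vecseq) : form p x y = form p y x.
Proof.
  unfold form; f_equal; apply sum_Z_ext; intros k; unfold Cdiv; ring.
Qed.

Definition scale_i : vecseq -> vecseq := mat2 Ci 0 0 Ci.

Lemma form_scale_i (p x y : vecseq) :
  form p (scale_i x) y = Ci * form p x y.
Proof.
  unfold form, sum_Z.
  rewrite (sum_ge_Ci 0 (form_density p x y)), (sum_le_Ci (-1) (form_density p x y)).
  - unfold form_density; ring.
  - intros j; unfold form_density, scale_i, mat2, fst_at, snd_at, Cdiv; cbn [fst snd]; ring.
  - intros j; unfold form_density, scale_i, mat2, fst_at, snd_at, Cdiv; cbn [fst snd]; ring.
Qed.

Lemma RtoC_m1 : RtoC (-1) = - (1).
Proof. now rewrite <- RtoC_opp. Qed.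

(** The form pairs the first component with the second, and [sigma3] gives them
    opposite signs. *)
Lemma form_sigma3 (p x y : vecseq) : form p (sigma3 x) y = - form p x (sigma3 y).
Proof.
  unfold form; f_equal; rewrite <- sum_Z_opp; apply sum_Z_ext; intros k.
  unfold sigma3, mat2, fst_at, snd_at, Cdiv; cbn [fst snd]; rewrite RtoC_m1; ring.
Qed.

Lemma sigma3_involutive (w : vecseq) : sigma3 (sigma3 w) = w.
Proof.
  apply functional_extensionality; intros k.
  unfold sigma3, mat2, fst_at, snd_at; cbn [fst snd]; rewrite RtoC_m1.
  apply injective_projections; cbn [fst snd]; ring.
Qed.

Definition rot : vecseq -> vecseq := mat2 0 1 (-1) 0.

Lemma form_rot (p x y : vecseq) :
  form p (rot x) y = form p x (rot y).
Proof.
  unfold form; f_equal; apply sum_Z_ext; intros k.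
  unfold rot, mat2, fst_at, snd_at, Cdiv; cbn [fst snd]; rewrite RtoC_m1; ring.
Qed.

(** * The operators act on the tangent space *)

Lemma s_seq_summable (p w : vecseq) :
  phase_space p -> tangent w -> abs_summable (s_seq p w).
Proof.
  intros Hp [Hu Hv]; pose proof (phase_space_inv_bounded p Hp) as Hm.
  destruct Hp as [_ [[Hq Hr] _]].
  unfold s_seq; summability.
Qed.

Lemma t_seq_summable (p w : vecseq) :
  phase_space p -> tangent w -> abs_summable (t_seq p w).
Proof.
  intros Hp [Hu Hv]; destruct Hp as [_ [[Hq Hr] _]].
  unfold t_seq; summability.
Qed.

(** [h_seq] and [g_seq] are the summands of the second nonlocal sums of [opL] and
    [opLinv].  Their difference [g_seq - h_seq] is [t_seq]. *)
Definition h_seq (p w : vecseq) (j : Z) : C :=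
  fst_at p j * fst_at w (j - 1)%Z - snd_at p j * snd_at w (j + 1)%Z.

Definition g_seq (p w : vecseq) (j : Z) : C :=
  fst_at p j * fst_at w (j + 1)%Z - snd_at p j * snd_at w (j - 1)%Z.

Lemma h_seq_summable (p w : vecseq) :
  phase_space p -> tangent w -> abs_summable (h_seq p w).
Proof.
  intros Hp [Hu Hv]; destruct Hp as [_ [[Hq Hr] _]].
  unfold h_seq; summability.
Qed.

Lemma g_seq_summable (p w : vecseq) :
  phase_space p -> tangent w -> abs_summable (g_seq p w).
Proof.
  intros Hp [Hu Hv]; destruct Hp as [_ [[Hq Hr] _]].
  unfold g_seq; summability.
Qed.

Lemma Lplus_tangent (p : vecseq) : phase_space p -> tangent_endo (Lplus p).
Proof.
  intros Hp w Hw.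
  pose proof (s_seq_summable p w Hp Hw) as Hs.
  pose proof (h_seq_summable p w Hp Hw) as Hh.
  pose proof (g_seq_summable p w Hp Hw) as Hg.
  destruct Hp as [_ [[Hq Hr] _]], Hw as [Hu Hv].
  apply addf_tangent; split; unfold opL, opLinv, fst_at at 1, snd_at at 1;
    cbn [fst snd]; fold (h_seq p w); fold (g_seq p w); summability.
Qed.

Lemma Lminus_tangent (p : vecseq) : phase_space p -> tangent_endo (Lminus p).
Proof.
  intros Hp w Hw.
  pose proof (s_seq_summable p w Hp Hw) as Hs.
  pose proof (t_seq_summable p w Hp Hw) as Ht.
  destruct Hp as [_ [[Hq Hr] _]], Hw as [Hu Hv].
  split; unfold Lminus, fst_at at 1, snd_at at 1; cbn [fst snd]; summability.
Qed.

(** * The adjoint of L + L^-1 *)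

(** The products [P * X] and [S * Y] are those of Abel summation: by the
    recurrences of the four sums, their differences contain all the terms in
    which [X] and [Y] occur, and leave terms linear in [P] and [S].  The
    coefficients of the latter combine with the shifted fields multiplying
    [P] and [S] in the operators into differences of the two symmetric
    expressions that stand before [P] and [S] below.  The last line accounts for
    the free shifts.  Prefix sums stop at [k - 1], so that they and the tails
    from [k] on split the lattice. *)
Definition boundary (p w w' : vecseq) (k : Z) : C :=
  let q := fst_at p in
  let r := snd_at p in
  let u := fst_at w in
  let v := snd_at w in
  let a := fst_at w' in
  let b := snd_at w' in
  let X := sum_ge k (g_seq p w) - sum_ge k (h_seq p w) in
  let S := sum_ge k (s_seq p w) in
  let P := sum_le (k - 1) (s_seq p (sigma3 w')) in
  let Y := sum_le (k - 1) (t_seq p (sigma3 w')) in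
  P * X + S * Y
  + (q k * u (k - 1)%Z + q (k - 1)%Z * u k
     + (r k * v (k - 1)%Z + r (k - 1)%Z * v k)) * P
  - (q k * a (k - 1)%Z + q (k - 1)%Z * a k
     - (r k * b (k - 1)%Z + r (k - 1)%Z * b k)) * S
  + (b (k - 1)%Z * u k - u (k - 1)%Z * b k
     + (a (k - 1)%Z * v k - v (k - 1)%Z * a k)).

(** Once every nonlocal sum is expressed by its value on one side of the site
    [k], these sums are independent unknowns and the claim is an identity of
    rational functions. *)
Lemma Lplus_density_difference (p w w' : vecseq) (k : Z) :
  phase_space p -> tangent w -> tangent w' ->
  form_density p (Lplus p w) w' k
  - form_density p w (sigma3 (Lminus p (sigma3 w'))) k
  = boundary p w w' (k + 1) - boundary p w w' k.
Proof.
  intros Hp Hw Hw'.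
  pose proof (mat2_tangent 1 0 0 (-1) w' Hw') as Hw''.
  pose proof (sum_ge_step k _ (s_seq_summable p w Hp Hw)) as Es.
  pose proof (sum_ge_step k _ (h_seq_summable p w Hp Hw)) as Eh.
  pose proof (sum_ge_step k _ (g_seq_summable p w Hp Hw)) as Eg.
  pose proof (sum_le_step k _ (s_seq_summable p _ Hp Hw'')) as Es'.
  pose proof (sum_le_step k _ (t_seq_summable p _ Hp Hw'')) as Et'.
  destruct Hp as [_ [_ Hm]]; specialize (Hm k).
  unfold boundary; replace (k + 1 - 1)%Z with k by lia.
  cbv beta iota zeta delta [form_density Lplus Lminus addf opL opLinv sigma3 mat2
    s_seq t_seq h_seq g_seq fst_at snd_at fst snd] in *.
  rewrite Es, Eh, Eg, Es', Et'; clear Es Eh Eg Es' Et'.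
  (* What remains of each sum is an opaque unknown of the identity. *)
  repeat match goal with
  | |- context [sum_ge ?m ?a] => generalize (sum_ge m a); intro
  | |- context [sum_le ?m ?a] => generalize (sum_le m a); intro
  end.
  destruct (p k) as [q r], (w k) as [u v], (w' k) as [a b].
  destruct (p (k - 1)%Z), (w (k - 1)%Z), (w' (k - 1)%Z).
  destruct (p (k + 1)%Z), (w (k + 1)%Z), (w' (k + 1)%Z).
  rewrite RtoC_m1.
  assert (Hm' : 1 - q * r <> 0) by (rewrite Cmult_comm; exact Hm).
  field; auto.
Qed.

Lemma boundary_Z_lim (p w w' : vecseq) :
  phase_space p -> tangent w -> tangent w' -> Z_lim (boundary p w w') 0 0.
Proof.
  intros Hp Hw Hw'.
  pose proof (mat2_tangent 1 0 0 (-1) w' Hw') as Hw''.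
  destruct (sum_ge_Z_lim _ (s_seq_summable p w Hp Hw)) as [ls Hs].
  destruct (sum_ge_Z_lim _ (h_seq_summable p w Hp Hw)) as [lh Hh].
  destruct (sum_ge_Z_lim _ (g_seq_summable p w Hp Hw)) as [lg Hg].
  destruct (sum_le_Z_lim _ (s_seq_summable p _ Hp Hw'')) as [ls' Hs'].
  destruct (sum_le_Z_lim _ (t_seq_summable p _ Hp Hw'')) as [lt' Ht'].
  destruct Hp as [_ [[Hq Hr] _]], Hw as [Hu Hv], Hw' as [Ha Hb].
  apply square_summable_Z_lim in Hq, Hr, Hu, Hv, Ha, Hb.
  pose proof (Z_lim_shift_pred _ _ _ Hq) as Hq1.
  pose proof (Z_lim_shift_pred _ _ _ Hr) as Hr1.
  pose proof (Z_lim_shift_pred _ _ _ Hu) as Hu1.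
  pose proof (Z_lim_shift_pred _ _ _ Hv) as Hv1.
  pose proof (Z_lim_shift_pred _ _ _ Ha) as Ha1.
  pose proof (Z_lim_shift_pred _ _ _ Hb) as Hb1.
  apply Z_lim_shift_pred in Hs', Ht'.
  assert (E : forall f lm lp, Z_lim f lm lp -> lm = 0 -> lp = 0 -> Z_lim f 0 0)
    by (intros f lm lp H <- <-; exact H).
  (* The limits of the separate terms are products such as [0 * lg], to be
     simplified only once they are all known. *)
  eapply E.
  - unfold boundary, Cminus.
    repeat first [ eassumption
                 | eapply (Z_lim_plus (fun k => _) (fun k => _))
                 | eapply (Z_lim_mult (fun k => _) (fun k => _))
                 | eapply (Z_lim_opp (fun k => _)) ].
  - ring.
  - ring.
Qed.

Lemma form_Lplus_Lminus (p w w' : vecseq) :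
  phase_space p -> tangent w -> tangent w' ->
  form p (Lplus p w) w' = form p w (sigma3 (Lminus p (sigma3 w'))).
Proof.
  intros Hp Hw Hw'.
  assert (T1 : tangent (Lplus p w)) by now apply Lplus_tangent.
  assert (T2 : tangent (sigma3 (Lminus p (sigma3 w'))))
    by now apply mat2_tangent, Lminus_tangent, mat2_tangent.
  assert (E : sum_Z (form_density p (Lplus p w) w')
              + - sum_Z (form_density p w (sigma3 (Lminus p (sigma3 w')))) = 0).
  { rewrite <- sum_Z_opp, <- sum_Z_plus
      by (try apply abs_summable_opp; apply form_density_summable; assumption).
    transitivity (RtoC 0 - 0); [|ring].
    rewrite <- (sum_Z_telescope (boundary p w w') 0 0)
      by (apply boundary_Z_lim; assumption).
    apply sum_Z_ext; intros k; now apply Lplus_density_difference. }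
  unfold form; fold (form_density p (Lplus p w) w').
  fold (form_density p w (sigma3 (Lminus p (sigma3 w')))).
  f_equal; rewrite <- (Cplus_0_r (sum_Z (form_density p w _))), <- E; ring.
Qed.

Lemma Lplus_adjoint (p : vecseq) :
  phase_space p ->
  is_adjoint p (Lplus p) (fun w => sigma3 (Lminus p (sigma3 w))).
Proof.
  intros Hp; split; [now apply Lplus_tangent|split].
  - intros w Hw; now apply mat2_tangent, Lminus_tangent, mat2_tangent.
  - intros w w' Hw Hw'; now apply form_Lplus_Lminus.
Qed.

(** * Skew-symmetry of K *)

Definition Lsum (p w : vecseq) : vecseq := addf (Lplus p w) (Lminus p w).

Lemma Lsum_tangent (p : vecseq) : phase_space p -> tangent_endo (Lsum p).
Proof.
  intros Hp w Hw; apply addf_tangent; [apply Lplus_tangent | apply Lminus_tangent];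
    assumption.
Qed.

(** If [B = sigma3 A^* sigma3], then [A + B] is fixed by [A |-> sigma3 A^* sigma3];
    the sign comes from moving [sigma3] across the form. *)
Lemma form_twisted_sum (p : vecseq) (A B : vecseq -> vecseq) (w w' : vecseq) :
  phase_space p -> tangent_endo B ->
  is_adjoint p A (fun x => sigma3 (B (sigma3 x))) -> tangent w -> tangent w' ->
  form p (addf (A w) (B w)) w'
  = - form p (sigma3 w) (addf (A (sigma3 w')) (B (sigma3 w'))).
Proof.
  intros Hp HB (HA & _ & adj) Hw Hw'.
  pose proof (mat2_tangent 1 0 0 (-1) w Hw : tangent (sigma3 w)) as Sw.
  pose proof (mat2_tangent 1 0 0 (-1) w' Hw' : tangent (sigma3 w')) as Sw'.
  rewrite (form_sym p (sigma3 w)), !form_addf_l by auto.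
  rewrite (adj w w'), (adj (sigma3 w') (sigma3 w)) by assumption.
  rewrite sigma3_involutive, (form_sigma3 p w'), sigma3_involutive.
  rewrite (form_sym p w (sigma3 _)), form_sigma3, (form_sym p w' (B w)).
  ring.
Qed.

Lemma form_Lsum_twisted (p w w' : vecseq) :
  phase_space p -> tangent w -> tangent w' ->
  form p (Lsum p w) w' = - form p (sigma3 w) (Lsum p (sigma3 w')).
Proof.
  intros Hp Hw Hw'.
  exact (form_twisted_sum p (Lplus p) (Lminus p) w w' Hp (Lminus_tangent p Hp)
           (Lplus_adjoint p Hp) Hw Hw').
Qed.

(** [sigma3 rot] and [rot^-1 J] agree only up to a factor [i], which has to be
    moved through the nonlocal sums. *)
Lemma Lsum_scale_i (p w : vecseq) : Lsum p (scale_i w) = scale_i (Lsum p w).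
Proof.
  assert (Es : forall j, s_seq p (scale_i w) j = Ci * s_seq p w j).
  { intros j; unfold s_seq, scale_i, mat2, fst_at, snd_at, Cdiv; cbn [fst snd]; ring. }
  assert (Et : forall j, t_seq p (scale_i w) j = Ci * t_seq p w j).
  { intros j; unfold t_seq, scale_i, mat2, fst_at, snd_at; cbn [fst snd]; ring. }
  assert (Eh : forall j, h_seq p (scale_i w) j = Ci * h_seq p w j).
  { intros j; unfold h_seq, scale_i, mat2, fst_at, snd_at; cbn [fst snd]; ring. }
  assert (Eg : forall j, g_seq p (scale_i w) j = Ci * g_seq p w j).
  { intros j; unfold g_seq, scale_i, mat2, fst_at, snd_at; cbn [fst snd]; ring. }
  apply functional_extensionality; intros k.
  pose proof (fun m => sum_ge_Ci m _ _ Es) as Fs.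
  pose proof (fun m => sum_le_Ci m _ _ Es) as Fs'.
  pose proof (fun m => sum_le_Ci m _ _ Et) as Ft.
  pose proof (fun m => sum_ge_Ci m _ _ Eh) as Fh.
  pose proof (fun m => sum_ge_Ci m _ _ Eg) as Fg.
  clear Es Et Eh Eg.
  cbv beta iota zeta delta [Lsum Lplus Lminus addf opL opLinv scale_i mat2
    s_seq t_seq h_seq g_seq fst_at snd_at fst snd] in *.
  rewrite !Fs, !Fs', !Ft, !Fh, !Fg.
  apply injective_projections; cbn [fst snd]; ring.
Qed.

Lemma Ci_sqr : Ci * Ci = - (1).
Proof. unfold Ci, Cmult, Copp, RtoC; cbn; f_equal; ring. Qed.
Lemma opK_skew (p : vecseq) : phase_space p -> skew_symmetric p (opK p).
Proof.
  intros Hp; split.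
  - intros w Hw; apply mat2_tangent, (Lsum_tangent p Hp), mat2_tangent, mat2_tangent, Hw.
  - intros w w' Hw Hw'.
    (* [N] is [rot^-1 J]. *)
    set (N := fun x => mat2 0 (-1) 1 0 (opJ x)).
    change (opK p w) with (rot (Lsum p (N w))).
    change (opK p w') with (rot (Lsum p (N w'))).
    rewrite form_rot.
    rewrite form_Lsum_twisted by (try assumption; repeat apply mat2_tangent; assumption).
    assert (E1 : sigma3 (rot w') = scale_i (N w')).
    { apply functional_extensionality; intros k.
      unfold N, rot, scale_i, sigma3, opJ, mat2, fst_at, snd_at; cbn [fst snd].
      rewrite RtoC_m1; apply injective_projections; cbn [fst snd]; ring [Ci_sqr]. }
    assert (E2 : scale_i (sigma3 (N w)) = rot w).
    { apply functional_extensionality; intros k.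
      unfold N, rot, scale_i, sigma3, opJ, mat2, fst_at, snd_at; cbn [fst snd].
      rewrite RtoC_m1; apply injective_projections; cbn [fst snd]; ring [Ci_sqr]. }
    rewrite E1, Lsum_scale_i, form_sym, form_scale_i, form_sym.
    now rewrite <- form_scale_i, E2, form_rot.
Qed.

Theorem theorem3 :
  forall p : vecseq, phase_space p ->
    is_adjoint p (Lplus p) (fun w => sigma3 (Lminus p (sigma3 w))) /\
    skew_symmetric p (opK p) /\
    (forall F G : functional, has_gradient F p -> has_gradient G p ->
       bracketK F G p = Copp (bracketK G F p)).
Proof.
  intros p Hp; split; [|split].
  - now apply Lplus_adjoint.
  - now apply opK_skew.
  - intros F G [_ HF] [_ HG]; unfold bracketK.
    rewrite form_sym; now apply (proj2 (opK_skew p Hp)).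
Qed.
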